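(* Let $d\ge1$ be an integer and $s,c>0$. Let $\{x_n\}_{n\ge1}\subset\mathbb{R}^d$, let $P_n=\{x_1,\dots,x_n\}$ (with $\#P_n=n$), and let $\kappa_{n,c}$ be the measures on $\mathbb{R}^d$ given by $$d\kappa_{n,c}(x)=n^{-1}\omega_d^{-1}c^{-d}n^{d/s}\sum_{a\in P_n}\mathbf{1}_{B(a,cn^{-1/s})}(x)\,dx,$$ where $\omega_d$ is the volume of the unit ball of $\mathbb{R}^d$. If $\{P_n\}$ is $s$-adaptable and $\kappa_{n,c}$ weak-$\star$ converges, as $n\to\infty$, to some Borel probability measure $\mu$ on $\mathbb{R}^d$, then $$\dim_{\mathcal H}(\operatorname{supp}(\mu))\ge s.$$
   Context: $B(a,r)$ is the Euclidean ball of center $a$ and radius $r$, and $\mathbf{1}_A$ is the indicator function of $A$. For a set $P\subset\mathbb{R}^d$ of $n\ge2$ points and $t>0$, the discrete $t$-energy is $J_t(P)=\frac{1}{n(n-1)}\sum_{x,y\in P,\ x\ne y}|x-y|^{-t}$ (sum over ordered pairs, Euclidean norm). A uniformly bounded sequence of sets $\{P_n\}$ in $\mathbb{R}^d$ with $\#P_n=n$ is called $s$-adaptable if for every $t\in(0,s)$ there is a finite constant $C_t$ with $J_t(P_n)\le C_t$ for all $n\ge2$. Weak-$\star$ convergence $\kappa_{n,c}\to\mu$ means $\int f\,d\kappa_{n,c}\to\int f\,d\mu$ for every bounded continuous $f:\mathbb{R}^d\to\mathbb{R}$. $\dim_{\mathcal H}$ denotes Hausdorff dimension; equivalently, with $I_u(\mu)=\iint|x-y|^{-u}\,d\mu(x)\,d\mu(y)$,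 $\dim_{\mathcal H}(E)=\sup\{\min\{\sup\{u\ge0: I_u(\mu)<\infty\},d\}:\mu$ a Borel probability measure with support in $E\}$. *)

(* Defs.v *)
From HB Require Import structures.
From mathcomp Require Import all_boot all_order all_algebra finmap.
From mathcomp Require Import all_classical all_reals all_analysis.
From mathcomp Require Import measurable_realfun lra.

Set Implicit Arguments.
Unset Strict Implicit.
Unset Printing Implicit Defensive.

Import Order.TTheory GRing.Theory Num.Theory.
Import numFieldNormedType.Exports.

Local Open Scope classical_set_scope.
Local Open Scope ring_scope.

(* R^d is 'rV[R]_d. The library's norm on row vectors is the sup norm, hence
   the separate Euclidean norm; both induce the library's topology. *)
Section euclidean.
Context {R : realType} {d : nat}.
Implicit Types x a : 'rV[R]_d.

Definition enorm x : R := Num.sqrt (\sum_(i < d) x ord0 i ^+ 2).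

Definition eball a (r : R) : set 'rV[R]_d := [set x | enorm (x - a) < r].

End euclidean.

Definition borel_rV (R : realType) (d : nat) :=
  g_sigma_algebraType (@open 'rV[R]_d).

(* Product measure lambda_1 (x) ... (x) lambda_1, transported along the
   identification of R * R^d with R^(1 + d). *)
Section lebesgue_rV.
Variable R : realType.

Definition cons_rV d (p : measurableTypeR R * borel_rV R d) :
  borel_rV R d.+1 := row_mx p.1%:M (p.2 : 'rV[R]_d).

Fixpoint lebesgue_rV (d : nat) : set (borel_rV R d) -> \bar R :=
  match d with
  | 0 => dirac ((0 : 'rV[R]_0) : borel_rV R 0)
  | d'.+1 => pushforward (lebesgue_measure \x @lebesgue_rV d')%E (@cons_rV d')
  end.

End lebesgue_rV.
Arguments lebesgue_rV {R} d A.

Section lebesgue_rV_measure.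
Variable R : realType.

Lemma open_measurable_rV d (U : set 'rV[R]_d) : open U ->
  measurable (U : set (borel_rV R d)).
Proof. by move=> oU; exact: sub_sigma_algebra. Qed.

Lemma continuous_measurable_rV d (f : 'rV[R]_d -> R) : continuous f ->
  measurable_fun [set: borel_rV R d] (f : borel_rV R d -> measurableTypeR R).
Proof.
move=> /continuousP cf; apply: (measurability _ (RGenOpens.measurableE R)).
move=> _ [_ [a [b ->] <-]]; rewrite setTI; apply: open_measurable_rV.
by apply: cf; exact: interval_open.
Qed.

Lemma measurable_cons_rV d : measurable_fun setT (@cons_rV R d).
Proof.
apply: (@measurability _ _ _ (borel_rV R d.+1) setT (@cons_rV R d)
  (@open 'rV[R]_d.+1) erefl).
move=> _ [U oU <-]; rewrite setTI.
pose c (q : rat * 'rV[rat]_d) : 'rV[R]_(1 + d) :=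
  row_mx (ratr q.1)%:M (map_mx ratr q.2).
pose F (q : rat * 'rV[rat]_d * nat) : set (measurableTypeR R * borel_rV R d) :=
  if `[< ball (c q.1) q.2.+1%:R^-1 `<=` U >] then
    ball (ratr q.1.1 : R) q.2.+1%:R^-1 `*`
    (ball (map_mx ratr q.1.2 : 'rV[R]_d) q.2.+1%:R^-1 : set (borel_rV R d))
  else set0.
have ballE q k (p : measurableTypeR R * borel_rV R d) :
    (ball (ratr q.1 : R) k.+1%:R^-1 p.1 /\
     ball (map_mx ratr q.2 : 'rV[R]_d) k.+1%:R^-1 p.2) <->
    ball (c q) k.+1%:R^-1 (cons_rV p : 'rV[R]_(1 + d)).
  split=> [[b1 [e0 b2]]|[e0 b]].
    split=> // i j; rewrite /c /cons_rV; case: (split_ordP j) => j' ->.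
      by rewrite !row_mxEl !mxE !ord1 eqxx !mulr1n.
    by rewrite !row_mxEr.
  split; last split=> // i j.
    have := b ord0 (lshift d ord0).
    by rewrite /c /cons_rV !row_mxEl !mxE eqxx !mulr1n.
  by have := b i (rshift 1 j); rewrite /c /cons_rV !row_mxEr.
rewrite (_ : _ @^-1` _ = \bigcup_q F q); last first.
  apply/seteqP; split=> [p Up|p [q _]]; last first.
    rewrite /F; case: ifPn => // /asboolP sU [b1 b2].
    by apply: sU; exact/ballE.
  have : nbhs (cons_rV p : 'rV[R]_(1 + d)) U by exact: open_nbhs_nbhs.
  rewrite -nbhs_ballE => -[e /= e0 eU].
  have [k ke] : exists k, k.+1%:R^-1 + k.+1%:R^-1 < e.
    have e20 : 0 < e / 2 by rewrite divr_gt0.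
    have /ltr_add_invr [k] := e20; rewrite add0r => ke.
    by exists k; rewrite [ltRHS]splitr ltrD.
  have k0 : 0 < k.+1%:R^-1 :> R by [].
  have rat_ball (y : R) : exists q : rat, ball (ratr q : R) k.+1%:R^-1 y.
    have /rat_in_itvoo[q] : y - k.+1%:R^-1 < y + k.+1%:R^-1.
      by rewrite ltrBlDr -addrA ltrDl addr_gt0.
    rewrite in_itv/= => /andP[q1 q2]; exists q.
    rewrite ball_symE/= /ball/= ltr_norml.
    move: q1 q2; set u := _^-1; move: (ratr q : R) => v q1 q2.
    by apply/andP; split; lra.
  have [f fP] := choice rat_ball.
  exists (f p.1, map_mx f (p.2 : 'rV[R]_d), k) => //.
  have bp : ball (c (f p.1, map_mx f (p.2 : 'rV[R]_d))) k.+1%:R^-1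
                 (cons_rV p : 'rV[R]_(1 + d)).
    apply/ballE; split=> /=; first exact: fP.
    by split=> // i j; rewrite !mxE; exact: fP.
  rewrite /F /=; case: ifPn => [_|/asboolP[] y yb]; first by move/ballE: bp.
  apply: eU; apply: le_ball (ltW ke) _ _.
  by apply: ball_triangle yb; exact: ball_sym.
apply: countable_bigcupT_measurable => [|q]; first exact: countableP.
rewrite /F; case: ifP => // _; apply: measurableX.
  by apply: open_measurable; exact: ball_open.
by apply: open_measurable_rV; exact: ball_open.
Qed.

Let cube : forall d : nat, nat -> set (borel_rV R d) :=
  fun d n => [set x : 'rV[R]_d | forall i, `|x ord0 i| <= n%:R].
Arguments cube : clear implicits.

Let cubeT d : [set: borel_rV R d] = \bigcup_n cube d n.
Proof.
apply/seteqP; split=> // x _.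
have [n xn] : exists n : nat, \sum_i `|(x : 'rV[R]_d) ord0 i| <= n%:R.
  exists (Num.truncn (\sum_i `|(x : 'rV[R]_d) ord0 i|)).+1.
  by rewrite ltW// truncnS_gt.
exists n => // i; apply: le_trans xn.
by rewrite (bigD1 i)//= lerDl sumr_ge0.
Qed.

Let measurable_cube d n : measurable (cube d n).
Proof.
have -> : cube d n = ~` \bigcup_(i : 'I_d)
    [set x : 'rV[R]_d | n%:R < `|x ord0 i|].
  apply/seteqP; split=> [x xn [i _ /=]|x xn i]; first by rewrite ltNge xn.
  by rewrite leNgt; apply/negP => xi; apply: xn; exists i.
apply: measurableC; apply: (@open_measurable_rV d).
apply: bigcup_open => i _.
have /continuousP : continuous (fun x : 'rV[R]_d => `|x ord0 i|).
  move=> x; apply: (@continuous_comp _ _ _ (fun x : 'rV[R]_d => x ord0 i)).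
    exact: coord_continuous.
  exact: norm_continuous.
move=> /(_ `]n%:R, +oo[%classic (interval_open _ _)) => /(_ isT isT).
by congr open; apply/seteqP; split=> y /=; rewrite in_itv/= andbT.
Qed.

Let cons_rV0 d p : (@cons_rV R d p : 'rV[R]_d.+1) ord0 ord0 = p.1.
Proof.
have -> : ord0 = lshift d (ord0 : 'I_1) :> 'I_(1 + d) by exact: val_inj.
by apply: etrans (row_mxEl _ _ _ _) _; rewrite mxE eqxx mulr1n.
Qed.

Let cons_rVS d p (i : 'I_d) :
  (@cons_rV R d p : 'rV[R]_d.+1) ord0 (lift ord0 i) = (p.2 : 'rV[R]_d) ord0 i.
Proof.
have -> : lift ord0 i = rshift 1 i :> 'I_(1 + d) by exact: val_inj.
exact: row_mxEr.
Qed.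

Let cubeS d n : @cons_rV R d @^-1` cube d.+1 n =
  `[- n%:R, n%:R]%classic `*` cube d n.
Proof.
apply/seteqP; split=> [p pn|p [/= + pn] i].
  split=> /= [|i]; last by rewrite -cons_rVS; exact: pn.
  by have := pn ord0; rewrite cons_rV0 ler_norml in_itv.
rewrite in_itv/= -ler_norml => p1n.
by case: (unliftP ord0 i) => [j|] ->; rewrite ?cons_rV0// cons_rVS; exact: pn.
Qed.

Lemma lebesgue_rV_sigma_finite d :
  exists m : {sigma_finite_measure set (borel_rV R d) -> \bar R},
    m = lebesgue_rV d :> (set _ -> \bar R) /\
    forall n, (m (cube d n) < +oo)%E.
Proof.
elim: d => [|d [m [mE mfin]]].
  exists (dirac ((0 : 'rV[R]_0) : borel_rV R 0)); split=> // n.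
  by rewrite /= diracE ltry.
pose nu : {measure set (borel_rV R d.+1) -> \bar R} :=
  measure_function_pushforward__canonical__measure_function_Measure
    (lebesgue_measure \x m)%E (@measurable_cons_rV d).
have nufin n : (nu (cube d.+1 n) < +oo)%E.
  rewrite /nu/= /pushforward cubeS product_measure1E//; last exact: measurable_cube.
  have [r r0 rE] : exists2 r : R, 0 <= r &
      (lebesgue_measure : set (measurableTypeR R) -> \bar R)
      `[- n%:R, n%:R]%classic = r%:E.
    rewrite lebesgue_measure_itv/= lte_fin; case: ifPn => [nn|_].
      by exists (n%:R - - n%:R); rewrite ?EFinB// subr_ge0 ltW.
    by exists 0.
  rewrite [X in (X * _ < _)%E](_ : _ = r%:E)//.
  by rewrite lte_mul_pinfty ?lee_fin// ?mfin.
have snu : sigma_finite setT nu.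
  exists (cube d.+1); first by rewrite cubeT.
  by move=> n; split; [exact: measurable_cube|exact: nufin].
pose M := Measure_isSigmaFinite.Build _ _ _ nu snu.
pose nu' : {sigma_finite_measure set (borel_rV R d.+1) -> \bar R} :=
  HB.pack (nu : set _ -> \bar R) (Measure.class nu) M.
exists nu'; split=> //=.
by rewrite /nu /= mE.
Qed.

Let lebesgue_rV0 d : @lebesgue_rV R d set0 = 0%E.
Proof. by have [m [<- _]] := lebesgue_rV_sigma_finite d. Qed.

Let lebesgue_rV_ge0 d A : (0 <= @lebesgue_rV R d A)%E.
Proof. by have [m [<- _]] := lebesgue_rV_sigma_finite d. Qed.

Let lebesgue_rV_sigma_additive d : semi_sigma_additive (@lebesgue_rV R d).
Proof.
have [m [<- _]] := lebesgue_rV_sigma_finite d.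
exact: measure_semi_sigma_additive.
Qed.

HB.instance Definition _ d := isMeasure.Build _ _ _ (@lebesgue_rV R d)
  (lebesgue_rV0 d) (@lebesgue_rV_ge0 d) (@lebesgue_rV_sigma_additive d).

Let sigma_finite_lebesgue_rV d : sigma_finite setT (@lebesgue_rV R d).
Proof.
have [m [<- _]] := lebesgue_rV_sigma_finite d; exact: sigma_finiteT.
Qed.

HB.instance Definition _ d := Measure_isSigmaFinite.Build _ _ _
  (@lebesgue_rV R d) (@sigma_finite_lebesgue_rV d).

End lebesgue_rV_measure.

Section energy.
Context {R : realType} {d : nat}.
Local Open Scope fset_scope.
Implicit Types P : {fset 'rV[R]_d}.

(* P_n = {x_1, ..., x_n}; the value x 0 plays no role. *)
Definition first_points (x : nat -> 'rV[R]_d) (n : nat) : {fset 'rV[R]_d} :=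
  [fset x i | i in iota 1 n].

Definition energy (t : R) P : R :=
  (#|` P| * #|` P|.-1)%:R^-1 *
  \sum_(x <- P) \sum_(y <- P | y != x) enorm (x - y) `^ (- t).

Definition adaptable (s : R) (P : nat -> {fset 'rV[R]_d}) : Prop :=
  [/\ forall n, (0 < n)%N -> #|` P n| = n,
      exists M : R, forall n x, (0 < n)%N -> x \in P n -> enorm x <= M &
      forall t : R, 0 < t < s ->
        exists C : R, forall n, (2 <= n)%N -> energy t (P n) <= C].

End energy.

Section kappa.
Context {R : realType} {d : nat}.
Implicit Types (s c : R) (P : {fset 'rV[R]_d}).

Definition unit_ball_volume : R :=
  fine (lebesgue_rV d (eball (0 : 'rV[R]_d) 1)).

Definition kappa_density s c (n : nat) P (x : 'rV[R]_d) : R :=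
  n%:R^-1 * unit_ball_volume^-1 * c ^- d * n%:R `^ (d%:R / s) *
  \sum_(a <- P) \1_(eball a (c * n%:R `^ (- s^-1))) x.

(* For c < 0 this is not a measure; the measure instance below needs 0 <= c. *)
Definition kappa s c n P : set (borel_rV R d) -> \bar R :=
  fun A => (\int[lebesgue_rV d]_(x in A) (kappa_density s c n P x)%:E)%E.

End kappa.

Section kappa_measure.
Context {R : realType} {d : nat}.

Lemma continuous_enorm : continuous (@enorm R d).
Proof.
have sum_continuous r :
    continuous (fun x : 'rV[R]_d => \sum_(i <- r) x ord0 i ^+ 2).
  elim: r => [|i r IH].
    have -> : (fun x : 'rV[R]_d => \sum_(i <- [::]) x ord0 i ^+ 2) = cst 0.
      by apply/funext => x; rewrite big_nil.
    exact: cst_continuous.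
  have -> : (fun x : 'rV[R]_d => \sum_(j <- i :: r) x ord0 j ^+ 2) =
      (fun x => x ord0 i ^+ 2 + \sum_(j <- r) x ord0 j ^+ 2).
    by apply/funext => x; rewrite big_cons.
  have sqr_continuous : continuous (fun x : 'rV[R]_d => x ord0 i ^+ 2).
    move=> x; apply: (@continuous_comp _ _ _
      (fun x : 'rV[R]_d => x ord0 i) (fun y : R => y ^+ 2)).
      exact: coord_continuous.
    exact: exprn_continuous.
  by move=> x; exact: continuousD (sqr_continuous x) (IH x).
move=> x; apply: (@continuous_comp _ _ _
  (fun x : 'rV[R]_d => \sum_(i < d) x ord0 i ^+ 2) Num.sqrt).
  exact: sum_continuous.
exact: sqrt_continuous.
Qed.

Lemma eball_open (a : 'rV[R]_d) r : open (eball a r).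
Proof.
have /continuousP : continuous (fun x : 'rV[R]_d => enorm (x - a)).
  move=> x; apply: (@continuous_comp _ _ _ (fun x : 'rV[R]_d => x - a)).
    apply: (@continuousB _ _ _ id (cst a) x); last exact: cst_continuous.
    by move=> A.
  exact: continuous_enorm.
by move=> /(_ [set y | y < r]); apply; exact: open_lt.
Qed.

Variables (s c : R) (c0 : 0 <= c) (n : nat) (P : {fset 'rV[R]_d}).

Lemma kappa_density_ge0 x : 0 <= kappa_density s c n P x.
Proof.
rewrite /kappa_density !mulr_ge0 ?invr_ge0 ?exprn_ge0 ?powR_ge0//.
  by rewrite fine_ge0.
by rewrite sumr_ge0.
Qed.

Lemma measurable_kappa_density :
  measurable_fun [set: borel_rV R d] (kappa_density s c n P).
Proof.
apply: measurable_funM; first exact: measurable_cst.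
apply: measurable_sum => a; apply: measurable_indic.
by apply: open_measurable_rV; exact: eball_open.
Qed.

Let kappa0 : kappa s c n P set0 = 0%E.
Proof. by rewrite /kappa integral_set0. Qed.

Let kappa_ge0 A : (0 <= kappa s c n P A)%E.
Proof.
by apply: integral_ge0 => x _; rewrite lee_fin kappa_density_ge0.
Qed.

Let kappa_sigma_additive : semi_sigma_additive (kappa s c n P).
Proof.
apply: semi_sigma_additive_nng_induced => [|x].
  by apply/measurable_EFinP; exact: measurable_kappa_density.
by rewrite lee_fin kappa_density_ge0.
Qed.

HB.instance Definition _ := isMeasure.Build _ _ _ (kappa s c n P)
  kappa0 kappa_ge0 kappa_sigma_additive.

End kappa_measure.

Section weak_convergence.
Context {R : realType} {d : nat}.

Definition weak_star_cvg (k : nat -> set (borel_rV R d) -> \bar R)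
    (mu : set (borel_rV R d) -> \bar R) : Prop :=
  forall f : 'rV[R]_d -> R, continuous f ->
    (exists M : R, forall x, `|f x| <= M) ->
    (\int[k n]_x (f x)%:E)%E @[n --> \oo] --> (\int[mu]_x (f x)%:E)%E.

Definition supp (mu : set (borel_rV R d) -> \bar R) : set 'rV[R]_d :=
  [set x | forall U : set 'rV[R]_d, open U -> U x -> (0 < mu U)%E].

End weak_convergence.

Section hausdorff.
Context {R : realType} {d : nat}.
Implicit Types (A E : set 'rV[R]_d) (u delta : R).
Local Open Scope ereal_scope.

Definition diam A : \bar R :=
  ereal_sup [set (enorm (x.1 - x.2))%:E | x in A `*` A].

(* diam(A)^u, where the empty set counts for 0 even when u = 0; since diam set0
   is -oo, the empty set is also admissible in every delta-cover. *)
Definition diam_pow u A : \bar R := if A == set0 then 0 else diam A `^ u.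

Definition hausdorff_pre u delta E : \bar R :=
  ereal_inf [set \sum_(0 <= i <oo) diam_pow u (U i) | U in
    [set U : (set 'rV[R]_d)^nat |
      E `<=` \bigcup_i U i /\ forall i, diam (U i) <= delta%:E]].

Definition hausdorff_measure u E : \bar R :=
  ereal_sup [set hausdorff_pre u delta E | delta in [set r | (0 < r)%R]].

Definition hausdorff_dim E : \bar R :=
  ereal_inf [set u%:E | u in [set u | (0 <= u)%R /\ hausdorff_measure u E = 0]].

End hausdorff.

(* Main.v *)
Require Import Defs.
From mathcomp Require Import all_boot all_order all_algebra finmap.
From mathcomp Require Import all_classical all_reals all_analysis.
From mathcomp Require Import measurable_realfun ring lra.

Set Implicit Arguments.
Unset Strict Implicit.
Unset Printing Implicit Defensive.

(** Suppose that the u-dimensional Hausdorff measure of supp mu vanishes for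
some u < s, and fix t strictly between u and s. Finite t-energy of mu would
exclude this; the energy argument is carried out here one scale at a time.

Fix r > 0 and a finite grid of mesh r. If N_z is the number of points among
x_1, ..., x_n near the grid point z, then the sum of the N_z^2 is at most a
constant times the number of pairs at distance O(r)
([sum_count_grid_sqr_le]), which the bound on the discrete t-energy makes
O(n + n^2 r^t) ([sum_count_le_energy]). The smearing of the points at scale
c n^(-1/s) is invisible at the fixed scale r when n is large, and each point
carries a mass O(1/n): Lebesgue measure is translation invariant and the total
mass of kappa_n tends to 1 ([kappa_le_count]). Testing the weak convergence
against finitely many tent functions therefore gives

  sum over z of mu (ball z (2 r))^2 <= C r^t,

with C independent of r and of the grid ([sum_grid_ball_sqr_le]).

By Markov's inequality along a geometric sequence of scales, mu satisfies the
Frostman condition mu (ball x rho) <= M rho^u for all rho < 1 and all x of a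
bounded region, outside a set of small measure ([frostman_off_small_set]). By
the mass distribution principle, the part of supp mu where this condition holds
would have arbitrarily small measure ([hausdorff_null_small_measure]). But mu
charges some ball, and the complement of its support is null
([negligible_setC_supp]).

Balls and grids refer to the sup norm, the norm [`| |] of row vectors; the
Euclidean norm enters only through the energy, kappa and the diameters. *)

Import Order.TTheory GRing.Theory Num.Theory.
Import numFieldNormedType.Exports.

Local Open Scope classical_set_scope.
Local Open Scope ring_scope.

(** * Norms, balls and powers *)

Lemma sup_norm_le_enorm (R : realType) d (x : 'rV[R]_d) : `|x| <= enorm x.
Proof.
rewrite [leLHS]/Num.norm/= mx_normrE; apply/bigmax_leP; split=> [|ij _].
  exact: sqrtr_ge0.
rewrite (ord1 ij.1) -sqrtr_sqr ler_wsqrtr// (bigD1 ij.2)//= lerDl.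
by apply: sumr_ge0 => i _; exact: sqr_ge0.
Qed.

Lemma coord_le_sup_norm (R : realType) d (x : 'rV[R]_d) i : `|x ord0 i| <= `|x|.
Proof.
rewrite [leRHS]/Num.norm/= mx_normrE; apply/bigmax_geP; right.
by exists (ord0, i).
Qed.

Lemma enorm_le_sup_norm (R : realType) d (x : 'rV[R]_d) :
  enorm x <= d%:R * `|x|.
Proof.
rewrite -[leRHS]ger0_norm ?mulr_ge0// -sqrtr_sqr ler_wsqrtr//.
apply: (@le_trans _ _ (\sum_(i < d) `|x| ^+ 2)).
  apply: ler_sum => i _; rewrite -real_normK ?num_real//.
  by rewrite lerXn2r ?nnegrE// coord_le_sup_norm.
rewrite sumr_const card_ord exprMn -[leLHS]mulr_natl ler_wpM2r ?sqr_ge0//.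
by rewrite -natrX ler_nat; case: (d) => // k; rewrite leq_pmulr.
Qed.

Lemma measurable_ball_rV (R : realType) d (p : 'rV[R]_d) r :
  measurable (ball p r : set (borel_rV R d)).
Proof. by apply: open_measurable_rV; exact: ball_open. Qed.

Lemma continuous_dist (R : realType) d (p : 'rV[R]_d) :
  continuous (fun y : 'rV[R]_d => `|y - p|).
Proof.
move=> y; apply: (@continuous_comp _ _ _ (fun y : 'rV[R]_d => y - p)).
  by apply: (@continuousB _ _ _ id (cst p)) => //; exact: cst_continuous.
exact: norm_continuous.
Qed.

Lemma measurable_dist_le (R : realType) d (p : 'rV[R]_d) D :
  measurable ([set y : 'rV[R]_d | `|y - p| <= D] : set (borel_rV R d)).
Proof.
have := continuous_measurable_rV (@continuous_dist _ _ p) measurableT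
  (measurable_itv `]-oo, D]).
by rewrite setTI; congr measurable; apply/seteqP; split=> y /=; rewrite in_itv.
Qed.

Lemma powR_lt1 (R : realType) (x a : R) : 0 < x < 1 -> 0 < a -> x `^ a < 1.
Proof.
move=> /andP[x0 x1] a0; rewrite [ltRHS](_ : 1 = 1 `^ a); last by rewrite powR1.
by apply: gt0_ltr_powR; rewrite ?nnegrE// ltW.
Qed.

(** * Translation invariance of Lebesgue measure *)

Lemma lebesgue_measure_preimage_shift (R : realType) (c : R)
    (A : set (measurableTypeR R)) : measurable A ->
  lebesgue_measure ((fun y => y + c : measurableTypeR R) @^-1` A) =
  lebesgue_measure A.
Proof.
move=> mA.
have ms : measurable_fun [set: measurableTypeR R]
    (fun y => y + c : measurableTypeR R).
  by apply: measurable_funD => //; exact: measurable_cst.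
pose m : {measure set (measurableTypeR R) -> \bar R} :=
  measure_function_pushforward__canonical__measure_function_Measure
    lebesgue_measure ms.
apply/esym; apply: (@lebesgue_measure_unique _ m) => // _ [[a b] _ <-].
rewrite /m/= /pushforward.
rewrite [X in _ = lebesgue_measure X](_ : _ = `]a - c, b - c]%classic).
  rewrite !lebesgue_measure_itv/= !lte_fin ltrD2r.
  by case: ifPn => // _; rewrite -!EFinB; congr (_%:E); lra.
by apply/seteqP; split=> y /=; rewrite !in_itv/= ltrBlDr lerBrDr.
Qed.

Lemma measurable_rV_continuous (R : realType) d (f : 'rV[R]_d -> 'rV[R]_d) :
  continuous f ->
  measurable_fun [set: borel_rV R d] (f : borel_rV R d -> borel_rV R d).
Proof.
move=> /continuousP cf.
apply: (@measurability _ _ (borel_rV R d) (borel_rV R d) setT f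
  (@open 'rV[R]_d) erefl).
move=> _ [U oU <-]; rewrite setTI.
by apply: open_measurable_rV; exact: cf.
Qed.

(** On R x R^d, translating both factors sends the product measure to a measure
that agrees with it on rectangles, so uniqueness of product measures lets the
invariance climb one dimension at a time. *)
Lemma lebesgue_rV_preimage_shift (R : realType) d (v : 'rV[R]_d)
    (A : set (borel_rV R d)) : measurable A ->
  lebesgue_rV d ((fun y : 'rV[R]_d => y + v) @^-1` A) = lebesgue_rV d A.
Proof.
have ms n (w : 'rV[R]_n) : measurable_fun [set: borel_rV R n]
    ((fun y : 'rV[R]_n => y + w) : borel_rV R n -> borel_rV R n).
  apply: measurable_rV_continuous => y.
  by apply: (@continuousD _ _ _ id (cst w) y) => //; exact: cst_continuous.
elim: d v A => [|d IH] v A mA.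
  by congr (lebesgue_rV 0 _); apply/seteqP; split=> y /=; rewrite !thinmx0.
rewrite /= /pushforward.
pose v0 := lsubmx (v : 'rV[R]_(1 + d)) ord0 ord0.
pose v1 := rsubmx (v : 'rV[R]_(1 + d)).
pose g (p : measurableTypeR R * borel_rV R d) :
    measurableTypeR R * borel_rV R d := (p.1 + v0, (p.2 : 'rV[R]_d) + v1).
have mg : measurable_fun setT g.
  apply: measurable_fun_pair.
    by apply: measurable_funD => //; exact: measurable_cst.
  by apply: (measurableT_comp (ms _ v1)); exact: measurable_snd.
have gE p : ((@cons_rV R d p : 'rV[R]_(1 + d)) + v : 'rV[R]_(1 + d)) =
    @cons_rV R d (g p).
  rewrite /cons_rV /g/= -[in LHS](@hsubmxK _ 1 1 d v).
  apply: etrans (add_row_mx _ _ _ _) _; congr (row_mx _ _).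
  by apply/matrixP => i j; rewrite /v0 !ord1 !mxE eqxx !mulr1n.
pose m : {measure set (measurableTypeR R * borel_rV R d)%type -> \bar R} :=
  measure_function_pushforward__canonical__measure_function_Measure
    (lebesgue_measure \x @lebesgue_rV R d)%E mg.
transitivity (m (@cons_rV R d @^-1` A)).
  congr ((_ \x _)%E _); apply/seteqP; split=> p /=.
    by rewrite -gE.
  by rewrite -gE.
apply/esym/product_measure_unique; last first.
  by rewrite -[X in measurable X]setTI; exact: measurable_cons_rV.
move=> B C mB mC; rewrite /m/= /pushforward.
have -> : g @^-1` (B `*` C) = ((fun y => y + v0 : measurableTypeR R) @^-1` B)
   `*` ((fun y : 'rV[R]_d => y + v1) @^-1` C : set (borel_rV R d)).
  by [].
rewrite product_measure1E.
- by congr (_ * _)%E; [exact: lebesgue_measure_preimage_shift|exact: IH].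
- rewrite -[X in measurable X]setTI.
  by apply: (measurable_funD (f := fun y : measurableTypeR R => y)
     (g := cst v0)) => //; exact: measurable_cst.
- by rewrite -[X in measurable X]setTI; exact: ms.
Qed.

Lemma lebesgue_rV_eball (R : realType) d (a : 'rV[R]_d) r :
  lebesgue_rV d (eball a r) = lebesgue_rV d (eball 0 r).
Proof.
have m0 : measurable (eball (0 : 'rV[R]_d) r : set (borel_rV R d)).
  by apply: open_measurable_rV; exact: eball_open.
rewrite -(lebesgue_rV_preimage_shift (- a) m0).
by congr (lebesgue_rV d _); apply/seteqP; split=> y; rewrite /eball/= subr0.
Qed.

(** * The mass of the smeared measures *)

Lemma kappaE (R : realType) d (s c : R) n (P : {fset 'rV[R]_d})
    (A : set (borel_rV R d)) : 0 <= c -> measurable A ->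
  kappa s c n P A = (\sum_(a <- P)
    (n%:R^-1 * (@unit_ball_volume R d)^-1 * c ^- d * n%:R `^ (d%:R / s))%:E *
    lebesgue_rV d (A `&` eball a (c * n%:R `^ (- s^-1))))%E.
Proof.
move=> c0 mA; set K := _ * _ * _ * _; set rho := c * _.
have K0 : 0 <= K.
  by rewrite !mulr_ge0 ?invr_ge0 ?exprn_ge0 ?powR_ge0// fine_ge0.
have mB a : measurable (eball a rho : set (borel_rV R d)).
  by apply: open_measurable_rV; exact: eball_open.
transitivity (\int[lebesgue_rV d]_(x in A)
    (\sum_(a <- P) (K%:E * (\1_(eball a rho) x)%:E)))%E.
  apply: eq_integral => x _; rewrite -/K.
  under eq_bigr do rewrite -EFinM; rewrite sumEFin; congr EFin.
  by rewrite /kappa_density -/K -/rho mulr_sumr.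
rewrite ge0_integral_sum//.
- apply: eq_bigr => a _; rewrite ge0_integralZl_EFin//.
    by rewrite integral_indic// setIC.
  by apply/measurable_EFinP; exact: measurable_indic.
- move=> a; apply: measurable_funeM.
  by apply/measurable_EFinP; exact: measurable_indic.
- by move=> a x _; rewrite -EFinM lee_fin mulr_ge0.
Qed.

(** By translation invariance all the balls around the points of P carry the
same kappa-mass, up to overlaps that are counted with multiplicity. So kappa(A)
is at most the total mass times the proportion of points whose ball can meet A.
Normalizing by the total mass spares the scaling law of Lebesgue measure, and
the value and positivity of the unit ball volume. *)
Lemma kappa_le_count (R : realType) d (s c : R) n (P : {fset 'rV[R]_d})
    (A : set (borel_rV R d)) (Q : pred 'rV[R]_d) : 0 <= c -> measurable A ->
  (forall a y, A y -> enorm (y - a) < c * n%:R `^ (- s^-1) -> Q a) ->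
  ((#|` P|%:R)%:E * kappa s c n P A <=
    (count Q P)%:R%:E * kappa s c n P setT)%E.
Proof.
move=> c0 mA AQ; rewrite !kappaE//; set K := _ * _ * _ * _; set rho := c * _.
have K0 : 0 <= K.
  by rewrite !mulr_ge0 ?invr_ge0 ?exprn_ge0 ?powR_ge0// fine_ge0.
have mB a : measurable (eball a rho : set (borel_rV R d)).
  by apply: open_measurable_rV; exact: eball_open.
pose w := (K%:E * lebesgue_rV d (eball (0 : 'rV[R]_d) rho))%E.
have w0 : (0 <= w)%E by rewrite mule_ge0.
have sum_w B : (\sum_(a <- P | B a) w = (count B P)%:R%:E * w)%E.
  elim: (enum_fset P) => [|a r IH]; first by rewrite big_nil mul0e.
  rewrite big_cons/= IH natrD EFinD ge0_muleDl ?lee_fin//.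
  by case: ifPn => _; rewrite ?mul1e// mul0e add0e.
have -> : (\sum_(a <- P) K%:E * lebesgue_rV d (setT `&` eball a rho) =
    #|` P|%:R%:E * w)%E.
  rewrite (eq_bigr (fun=> w)) => [|a _]; last by rewrite setTI lebesgue_rV_eball.
  by rewrite sum_w count_predT.
rewrite muleCA lee_wpmul2l ?lee_fin//.
apply: (@le_trans _ _ (\sum_(a <- P | Q a) w)%E).
  rewrite [leRHS]big_mkcond/=; apply: lee_sum => a _; case: ifPn => [_|nQ].
    rewrite lee_wpmul2l ?lee_fin// -(lebesgue_rV_eball a).
    by apply: le_measure; rewrite ?inE//; exact: measurableI.
  rewrite (_ : A `&` _ = set0) ?measure0 ?mule0// -subset0 => y [Ay ya].
  by case/negP: nQ; exact: AQ Ay ya.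
by rewrite sum_w.
Qed.

(** * Counting close pairs on a grid *)

(** The integers within k of y lie within 2k of the smallest of them. *)
Lemma card_nat_near_le (R : realType) (y : R) k N :
  (#|[set j : 'I_N | (`|y - j%:R| < k%:R)%R]%SET| <= k.*2.+1)%N.
Proof.
set A := finset _; have [->|[j0 j0A]] := set_0Vmem A; first by rewrite cards0.
have [m mA mmin] : exists2 m : 'I_N, m \in A &
    forall j : 'I_N, j \in A -> (m <= j)%N.
  by case: (@arg_minnP _ j0 (mem A) (@nat_of_ord N) j0A) => m; exists m.
have A_lt j : j \in A -> (j - m < k.*2.+1)%N.
  move=> jA; rewrite ltnS leq_subLR -(ler_nat R) natrD -addnn natrD.
  move: jA mA; rewrite !inE !ltr_norml => /andP[? ?] /andP[? ?]; lra.
rewrite -[leqRHS]card_ord.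
apply: (@leq_card_in _ _ (fun j : 'I_N => inord (j - m) : 'I_k.*2.+1)).
move=> i j iA jA /(congr1 (@nat_of_ord _)) /=; rewrite !inordK ?A_lt// => ijm.
by apply/val_inj; rewrite /= -(subnK (mmin i iA)) ijm subnK// mmin.
Qed.

Definition grid_point (R : realType) d (L r : R) N (z : {ffun 'I_d -> 'I_N}) :
  'rV[R]_d := \row_i (r * (z i)%:R - L).

(** Bounded overlap of the grid: for the sup norm the condition is a conjunction
over the coordinates, so the count factors into one-dimensional counts. *)
Lemma sum_grid_near_le (R : realType) d (L r : R) N (a : 'rV[R]_d) k : 0 < r ->
  (\sum_(z : {ffun 'I_d -> 'I_N})
     (`|a - grid_point L r z| < k%:R * r)%R <= k.*2.+1 ^ d)%N.
Proof.
move=> r0.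
pose y i : R := (a ord0 i + L) / r.
apply: (@leq_trans (\sum_(z : {ffun 'I_d -> 'I_N})
    \prod_i (`|y i - (z i)%:R| < k%:R)%R)%N).
  apply: leq_sum => z _; case: ltP => // az; rewrite big1// => i _.
  suff -> : `|y i - (z i)%:R| < k%:R by [].
  have := le_lt_trans (coord_le_sup_norm _ i) az; rewrite !mxE => azi.
  rewrite -(ltr_pM2r r0) -[X in _ * X < _](gtr0_norm r0) -normrM mulrBl.
  by rewrite /y divfK ?gt_eqF//; congr (`|_| < _): azi; lra.
rewrite -(bigA_distr_bigA (fun i (j : 'I_N) => (`|y i - j%:R| < k%:R)%R : nat)).
apply: (@leq_trans (\prod_(i < d) k.*2.+1)%N); last first.
  by rewrite prod_nat_const card_ord.
apply: leq_prod => i _; apply: leq_trans (card_nat_near_le (y i) k N).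
rewrite -sum1_card [leqRHS]big_mkcond/=; apply: leq_sum => j _.
by rewrite inE; case: ifP.
Qed.

(** The squared count of the points near a grid point counts pairs, and the
members of such a pair are close to each other. Each close pair is charged only
to the boundedly many grid points near one of its members. *)
Lemma sum_count_grid_sqr_le (R : realType) d (L r : R) N (P : seq 'rV[R]_d) :
  0 < r ->
  (\sum_(z : {ffun 'I_d -> 'I_N})
     count (fun a => `|a - grid_point L r z| < 4 * r)%R P ^ 2 <=
   9 ^ d * \sum_(a <- P) count (fun b => `|a - b| < 8 * r)%R P)%N.
Proof.
move=> r0; pose near a (z : {ffun 'I_d -> 'I_N}) : bool :=
  `|a - grid_point L r z| < 4 * r.
have countE (B : pred 'rV[R]_d) : count B P = (\sum_(a <- P) B a)%N.
  by rewrite -sum1_count big_mkcond; apply: eq_bigr => a _; case: (B a).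
apply: (@leq_trans (\sum_(a <- P) \sum_(b <- P)
    (`|a - b| < 8 * r)%R * \sum_z near a z)%N); last first.
  rewrite big_distrr/=; apply: leq_sum => a _; rewrite -big_distrl/= -countE.
  by rewrite mulnC leq_mul2r sum_grid_near_le// orbT.
rewrite (eq_bigr (fun z => \sum_(a <- P) \sum_(b <- P) near a z * near b z)%N).
  rewrite exchange_big/=; apply: leq_sum => a _.
  rewrite exchange_big/=; apply: leq_sum => b _.
  rewrite big_distrr/=; apply: leq_sum => z _.
  rewrite mulnC; case: (boolP (near b z)) => // bz; case: (boolP (near a z)).
    move=> az; suff -> : `|a - b| < 8 * r by [].
    have -> : a - b = (a - grid_point L r z) - (b - grid_point L r z).
      by rewrite opprB addrA subrK.
    apply: le_lt_trans (ler_normB _ _) _.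
    rewrite (_ : 8 * r = 4 * r + 4 * r) ?ltrD//; lra.
  by rewrite muln0.
by move=> z _; rewrite countE expnS expn1 big_distrlr.
Qed.

(** Markov's inequality for the kernel |a - b|^-t: a pair of distinct points at
distance below rho adds at least (d rho)^-t to the energy, where the factor d
compares the two norms. The first summand #|P| accounts for the pairs (a, a). *)
Lemma sum_count_le_energy (R : realType) d (t rho : R) (P : {fset 'rV[R]_d}) :
  0 < t -> 0 < rho ->
  (\sum_(a <- P) count (fun b => `|a - b| < rho)%R P)%:R <=
  #|` P|%:R + (d%:R * rho) `^ t * ((#|` P| * #|` P|.-1)%:R * energy t P).
Proof.
move=> t0 rho0.
have [n1|n1] := leqP #|` P| 1.
  have -> : (#|` P| * #|` P|.-1)%N = 0%N by case: #|` P| n1 => [|[|]].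
  rewrite mul0r mulr0 addr0 ler_nat.
  apply: (@leq_trans (\sum_(a <- P) 1)%N); last by rewrite sum1_size.
  by apply: leq_sum => a _; apply: leq_trans n1; exact: count_size.
rewrite /energy mulVKf; last first.
  by rewrite pnatr_eq0 muln_eq0 negb_or -!lt0n; case: #|` P| n1 => [|[|]].
apply: (@le_trans _ _ (\sum_(a <- P) (1 + \sum_(b <- P | b != a)
    (d%:R * rho) `^ t * enorm (a - b) `^ (- t)))); last first.
  rewrite big_split/= mulr_sumr; apply: lerD.
    by rewrite big_const_seq count_predT iter_addr_0.
  by apply: ler_sum => a _; rewrite mulr_sumr.
rewrite natr_sum; rewrite big_seq [leRHS]big_seq; apply: ler_sum => a aP.
rewrite -sum1_count natr_sum big_mkcond/= (bigD1_seq a)//=; apply: lerD.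
  by case: ifP.
apply: ler_sum => b ba; case: ifPn => [ab|_]; last by rewrite mulr_ge0 ?powR_ge0.
have e0 : 0 < enorm (a - b).
  apply: lt_le_trans (sup_norm_le_enorm _).
  by rewrite normr_gt0 subr_eq0 eq_sym.
rewrite powRN -[leLHS](@divff _ (enorm (a - b) `^ t)) ?gt_eqF ?powR_gt0//.
rewrite ler_wpM2r ?invr_ge0 ?powR_ge0//; apply: ge0_ler_powR.
- exact: ltW.
- exact: ltW.
- by rewrite nnegrE mulr_ge0// ltW.
- by apply: le_trans (enorm_le_sup_norm _) _; rewrite ler_wpM2l// ltW.
Qed.

(** * Tent functions *)

(** A continuous test function between the indicators of the balls of radii 2r
and 3r: weak convergence only speaks of continuous functions. *)
Definition tent (R : realType) d (p : 'rV[R]_d) (r : R) (x : 'rV[R]_d) : R :=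
  Num.max 0 (Num.min 1 (3 - `|x - p| / r)).

Section tent_theory.
Variables (R : realType) (d : nat) (p : 'rV[R]_d) (r : R).
Hypothesis r0 : 0 < r.

Lemma tent_ge0 x : 0 <= tent p r x.
Proof. by rewrite /tent le_max lexx. Qed.

Lemma tent_le1 x : tent p r x <= 1.
Proof. by rewrite /tent ge_max ler01 ge_min lexx. Qed.

Lemma tent_eq1 x : ball p (2 * r) x -> tent p r x = 1.
Proof.
rewrite -ball_normE/= distrC => xp.
have : `|x - p| / r <= 2 by rewrite ler_pdivrMr// ltW.
by rewrite /tent => xpr; rewrite min_l ?max_r//; lra.
Qed.

Lemma tent_eq0 x : ~ ball p (3 * r) x -> tent p r x = 0.
Proof.
rewrite -ball_normE/= distrC => /negP; rewrite -leNgt -ler_pdivlMr// => xp.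
by rewrite /tent max_l// ge_min; apply/orP; right; lra.
Qed.

Lemma continuous_tent : continuous (tent p r).
Proof.
move=> x; have cst_cont (k : R) : {for x, continuous (fun=> k : R)}.
  exact: cst_continuous.
have dist_cont : {for x, continuous (fun y : 'rV[R]_d => `|y - p|)}.
  exact: continuous_dist.
have lin_cont := continuousB (cst_cont 3) (continuousM dist_cont (cst_cont r^-1)).
exact: continuous_max (cst_cont 0) (continuous_min (cst_cont 1) lin_cont).
Qed.

Variable m : {measure set (borel_rV R d) -> \bar R}.

Lemma integral_tent_ge0 : (0 <= \int[m]_x (tent p r x)%:E)%E.
Proof. by apply: integral_ge0 => x _; rewrite lee_fin tent_ge0. Qed.

Let measurable_tent : measurable_fun [set: borel_rV R d] (EFin \o tent p r).
Proof.
by apply/measurable_EFinP; exact: continuous_measurable_rV continuous_tent.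
Qed.

Lemma integral_tent_le : (\int[m]_x (tent p r x)%:E <= m (ball p (3 * r)))%E.
Proof.
rewrite -[X in m X]setIT -integral_indic//; last exact: measurable_ball_rV.
apply: ge0_le_integral => //.
- by move=> x _; rewrite lee_fin tent_ge0.
- by apply/measurable_EFinP; apply: measurable_indic; exact: measurable_ball_rV.
move=> x _; rewrite lee_fin indicE; case: (boolP (x \in _)) => [_|].
  exact: tent_le1.
by rewrite notin_setE => /tent_eq0 ->.
Qed.

Lemma integral_tent_ge : (m (ball p (2 * r)) <= \int[m]_x (tent p r x)%:E)%E.
Proof.
rewrite -[X in m X]setIT -integral_indic//; last exact: measurable_ball_rV.
apply: ge0_le_integral => //.
- by apply/measurable_EFinP; apply: measurable_indic; exact: measurable_ball_rV.
move=> x _; rewrite lee_fin indicE; case: (boolP (x \in _)) => [|_].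
  by rewrite inE => /tent_eq1 ->.
exact: tent_ge0.
Qed.

End tent_theory.

(** * The energy bound in the weak limit *)

Lemma near_natV_powR_le (R : realType) (s c r : R) : 0 < s -> 0 < c -> 0 < r ->
  \forall n \near \oo, c * n%:R `^ (- s^-1) <= r.
Proof.
move=> s0 c0 r0; near=> n.
have n0 : 0 < n%:R :> R by rewrite ltr0n; near: n; exact: nbhs_infty_gt.
rewrite powRN ler_pdivrMr ?powR_gt0// -ler_pdivrMl// mulrC.
have sN0 : s != 0 by rewrite gt_eqF.
have cr0 : 0 <= c / r by rewrite divr_ge0// ltW.
rewrite -[leLHS]powRr1// -[X in _ `^ X <= _](divff sN0).
rewrite powRrM; apply: ge0_ler_powR.
- by rewrite invr_ge0 ltW.
- by rewrite nnegrE powR_ge0.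
- by rewrite nnegrE.
by near: n; exact: nbhs_infty_ger.
Unshelve. all: by end_near. Qed.

Lemma integral_tent_kappa_le (R : realType) d (s c : R) n (P : {fset 'rV[R]_d})
    (p : 'rV[R]_d) r : 0 <= c -> (0 < n)%N -> #|` P| = n -> 0 < r ->
  c * n%:R `^ (- s^-1) <= r -> (kappa s c n P setT <= 2%:E)%E ->
  (\int[kappa s c n P]_x (tent p r x)%:E <=
    (2 / n%:R * (count (fun a => `|a - p| < 4 * r) P)%:R)%:E)%E.
Proof.
move=> c0 n0 Pn r0 cn mass.
pose m : {measure set (borel_rV R d) -> \bar R} :=
  Defs_kappa__canonical__measure_function_Measure s c0 n P.
apply: le_trans (integral_tent_le p r0 m) _.
have -> : 2 / n%:R * (count (fun a => `|a - p| < 4 * r) P)%:R =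
    n%:R^-1 * ((count (fun a => `|a - p| < 4 * r) P)%:R * 2) :> R.
  by rewrite mulrAC mulrC (mulrC 2).
rewrite EFinM lee_pdivlMl ?ltr0n//.
apply: (@le_trans _ _ ((count (fun a => `|a - p| < 4 * r) P)%:R%:E *
  kappa s c n P setT)%E); last by rewrite [leRHS]EFinM lee_wpmul2l// lee_fin.
rewrite -[X in (X%:R%:E * m _ <= _)%E]Pn; apply: kappa_le_count => // [|a y].
  exact: measurable_ball_rV.
rewrite -ball_normE/= => py ya; rewrite distrC.
rewrite -(subrK y p) -addrA; apply: le_lt_trans (ler_normD _ _) _.
have := le_lt_trans (sup_norm_le_enorm _) ya; lra.
Qed.

(** This replaces the bound on the t-energy of mu: it is what finiteness of
that energy gives at the single scale r. Squares of integrals of finitely many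
continuous functions pass to the weak limit, so no convergence of the product
measures is needed. For the approximating measures the sum is at most a
constant times the proportion of 8r-close pairs among the first n points, which
the energy bound controls. The pairs (a, a) contribute 1/n, which is negligible
as n grows with r fixed. *)
Lemma sum_grid_ball_sqr_le (R : realType) d (s c t : R)
    (P : nat -> {fset 'rV[R]_d}) (mu : probability (borel_rV R d) R) :
  0 < s -> 0 < c -> 0 < t < s -> adaptable s P ->
  weak_star_cvg (fun n => kappa s c n (P n)) mu ->
  exists2 C : R, 0 <= C & forall (L r : R) N, 0 < r ->
    \sum_(z : {ffun 'I_d -> 'I_N})
      fine (mu (ball (grid_point L r z) (2 * r))) ^+ 2 <= C * r `^ t.
Proof.
move=> s0 c0 ts [cardP _ /(_ t ts)[C0 energyC]] kmu.
have t0 : 0 < t by case/andP: ts.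
pose C := (4 * 9 ^+ d) * (1 + (d%:R * 8) `^ t * `|C0|).
exists C => [|L r N r0]; first by rewrite /C !mulr_ge0 ?addr_ge0 ?mulr_ge0 ?powR_ge0.
pose I (z : {ffun 'I_d -> 'I_N}) n : \bar R :=
  (\int[kappa s c n (P n)]_x (tent (grid_point L r z) r x)%:E)%E.
pose J (z : {ffun 'I_d -> 'I_N}) : \bar R :=
  (\int[mu]_x (tent (grid_point L r z) r x)%:E)%E.
have IJ z : I z n @[n --> \oo] --> J z.
  apply: kmu; first exact: continuous_tent.
  by exists 1 => x; rewrite ger0_norm ?tent_ge0// tent_le1.
have Jfin z : J z \is a fin_num.
  rewrite ge0_fin_numE; last exact: integral_tent_ge0.
  apply: le_lt_trans (integral_tent_le _ r0 _) _.
  by apply: le_lt_trans (probability_le1 _ _) _; rewrite ?ltry//;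
    exact: measurable_ball_rV.
apply: (@le_trans _ _ (\sum_z fine (J z) ^+ 2)).
  apply: ler_sum => z _; rewrite lerXn2r ?nnegrE ?fine_ge0//.
    exact: integral_tent_ge0.
  rewrite fine_le//; last exact: integral_tent_ge.
  by rewrite fin_num_measure//; exact: measurable_ball_rV.
have fIJ z : fine (I z n) @[n --> \oo] --> fine (J z).
  by apply: fine_cvg; rewrite fineK.
(* Testing the convergence against the constant 1 bounds the total mass. *)
have mass : \forall n \near \oo, (kappa s c n (P n) setT <= 2%:E)%E.
  have massE (m : {measure set (borel_rV R d) -> \bar R}) :
      (\int[m]_x (1 : R)%:E = m setT)%E.
    by rewrite (integral_cst m measurableT) mul1e.
  have : kappa s c n (P n) setT @[n --> \oo] --> 1%:E.
    rewrite -(probability_setT mu) -massE.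
    rewrite (_ : (fun n => _) = (fun n => \int[kappa s c n (P n)]_x (1 : R)%:E)%E).
      apply: (kmu (cst 1)); first exact: cst_continuous.
      by exists 1 => x; rewrite normr1.
    apply/funext => n; apply/esym.
    exact: (massE
      (Defs_kappa__canonical__measure_function_Measure s (ltW c0) n (P n))).
  case/fine_cvgP => fin_mass /cvgr_lt/(_ 2 (ltr1n _ 2)) lt_mass.
  near=> n; rewrite -[leLHS]fineK; last by near: n.
  by rewrite lee_fin ltW//; near: n.
have sumIJ : \sum_z fine (I z n) ^+ 2 @[n --> \oo] --> \sum_z fine (J z) ^+ 2.
  apply: cvg_big => [|z _]; first exact: add_continuous.
  by apply: cvgM; exact: fIJ.
apply: (cvgr_to_le sumIJ); near=> n.
have n0 : (0 < n)%N by near: n; exact: nbhs_infty_gt.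
have nR0 : 0 < n%:R :> R by rewrite ltr0n.
have nrt : n%:R^-1 <= r `^ t.
  rewrite invf_ple ?posrE ?powR_gt0//; near: n; exact: nbhs_infty_ger.
have IE0 z : (0 <= I z n)%E.
  exact: (integral_tent_ge0 _ _
    (Defs_kappa__canonical__measure_function_Measure s (ltW c0) n (P n))).
have IEle z : (I z n <= (2 / n%:R *
    (count (fun a => `|a - grid_point L r z| < 4 * r) (P n))%:R)%:E)%E.
  apply: integral_tent_kappa_le => //; first exact: ltW.
  - exact: cardP.
  - by near: n; exact: near_natV_powR_le.
  - by near: n.
have Ile z : fine (I z n) <=
    2 / n%:R * (count (fun a => `|a - grid_point L r z| < 4 * r) (P n))%:R.
  rewrite -lee_fin fineK// ge0_fin_numE//.
  exact: le_lt_trans (IEle z) (ltry _).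
have I0 z : 0 <= fine (I z n) by rewrite fine_ge0.
apply: (@le_trans _ _ (4 / n%:R ^+ 2 * (\sum_(z : {ffun 'I_d -> 'I_N})
     count (fun a => `|a - grid_point L r z| < 4 * r)%R (P n) ^ 2)%:R)).
  rewrite natr_sum mulr_sumr; apply: ler_sum => z _.
  apply: (@le_trans _ _ ((2 / n%:R *
    (count (fun a => `|a - grid_point L r z| < 4 * r) (P n))%:R) ^+ 2)).
    by rewrite lerXn2r ?nnegrE// (le_trans (I0 z) (Ile z)).
  rewrite natrX !exprMn exprVn (_ : 4 = 2 ^+ 2)//; ring.
apply: (@le_trans _ _ (4 / n%:R ^+ 2 * (9 ^ d *
    \sum_(a <- P n) count (fun b => `|a - b| < 8 * r)%R (P n))%:R)).
  rewrite ler_wpM2l ?divr_ge0// ?exprn_ge0// ler_nat.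
  exact: sum_count_grid_sqr_le.
set S := (\sum_(a <- P n) _)%N.
have r80 : 0 < 8 * r by rewrite mulr_gt0.
have n1 : (1 < n)%N by near: n; exact: nbhs_infty_gt.
(* The diagonal pairs: this is where n has to be large compared to r. *)
have n_le : n%:R <= n%:R ^+ 2 * r `^ t.
  by rewrite expr2 -mulrA -[leLHS]mulr1 ler_pM2l// -ler_pdivrMl// mulr1.
have energy_le : (n * n.-1)%:R * energy t (P n) <= n%:R ^+ 2 * `|C0|.
  apply: (@le_trans _ _ ((n * n.-1)%:R * `|C0|)).
    by rewrite ler_wpM2l// (le_trans (energyC n n1))// ler_norm.
  by rewrite ler_wpM2r// -natrX ler_nat expnS expn1 leq_mul2l leq_pred orbT.
have Sle : S%:R <= n%:R ^+ 2 * ((1 + (d%:R * 8) `^ t * `|C0|) * r `^ t).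
  apply: le_trans (sum_count_le_energy (P n) t0 r80) _; rewrite cardP//.
  apply: le_trans (lerD n_le (ler_wpM2l (powR_ge0 _ _) energy_le)) _.
  rewrite [d%:R * _]mulrA powRM ?mulr_ge0//; last exact: ltW.
  by rewrite le_eqVlt; apply/orP; left; apply/eqP; ring.
rewrite natrM natrX mulrCA /C -[leRHS]mulrA.
apply: (@le_trans _ _ (9 ^+ d * (4 * ((1 + (d%:R * 8) `^ t * `|C0|) * r `^ t)))).
  rewrite ler_wpM2l ?exprn_ge0// -mulrA ler_wpM2l//.
  by rewrite ler_pdivrMl ?exprn_gt0.
by rewrite mulrCA mulrA.
Unshelve. all: by end_near. 
Qed.

(** * Support and bounded regions of positive measure *)

(** Every point outside the support has a null neighbourhood, hence lies in a
null ball with rational center and radius, and there are countably many. *)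
Lemma negligible_setC_supp (R : realType) d
    (mu : {measure set (borel_rV R d) -> \bar R}) :
  mu.-negligible (~` supp mu).
Proof.
pose V (q : 'rV[rat]_d * nat) : set (borel_rV R d) :=
  ball (map_mx ratr q.1 : 'rV[R]_d) q.2.+1%:R^-1.
pose F n : set (borel_rV R d) := 
  if (choice.unpickle n : option ('rV[rat]_d * nat)) is Some q then
  if mu (V q) == 0%E then V q else set0 else set0.
have [k|N [mN N0 FN]] := @negligible_bigcup _ _ _ mu F.
  rewrite /F; case: (choice.unpickle k) => [q|]; last exact: negligible_set0.
  case: ifPn => [/eqP q0|_]; last exact: negligible_set0.
  by exists (V q); split => //; exact: measurable_ball_rV.
exists N; split=> //; apply: subset_trans FN => x /existsNP[U].
move=> /not_implyP[oU] /not_implyP[Ux /negP]; rewrite -leNgt => U0.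
have : nbhs x U by exact: open_nbhs_nbhs.
rewrite -nbhs_ballE => -[e /= e0 eU].
have e20 : 0 < e / 2 by rewrite divr_gt0.
have /ltr_add_invr [k] := e20; rewrite add0r => ke.
have k0 : 0 < k.+1%:R^-1 :> R by [].
have rat_ball (y : R) : exists q : rat, ball (ratr q : R) k.+1%:R^-1 y.
  have /rat_in_itvoo[q] : y - k.+1%:R^-1 < y + k.+1%:R^-1.
    by rewrite ltrBlDr -addrA ltrDl addr_gt0.
  rewrite in_itv/= => /andP[q1 q2]; exists q.
  rewrite ball_symE/= /ball/= ltr_norml.
  move: q1 q2; set u := _^-1; move: (ratr q : R) => v q1 q2.
  by apply/andP; split; lra.
have [f fP] := choice rat_ball.
pose q := (map_mx f x, k).
have qx : V q x by split=> // i j; rewrite !mxE; exact: fP.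
have qU : V q `<=` U.
  move=> y qy; apply: eU; apply: (@le_ball _ _ _ (k.+1%:R^-1 + k.+1%:R^-1)).
    by rewrite [leRHS]splitr ltW// ltrD.
  by apply: ball_triangle qy; exact: ball_sym.
exists (choice.pickle q) => //; rewrite /F choice.pickleK ifT//.
rewrite -measure_le0; apply: le_trans U0.
by apply: le_measure; rewrite ?inE//; [exact: measurable_ball_rV|
  exact: open_measurable_rV].
Qed.

Lemma exists_ball_measure_gt0 (R : realType) d
    (mu : probability (borel_rV R d) R) :
  exists n : nat, (0 < mu (ball (0 : 'rV[R]_d)%R n%:R%R))%E.
Proof.
apply: contrapT => /forallNP ball0.
have [k|N [mN N0 NT]] := @negligible_bigcup _ _ _ mu
    (fun n : nat => ball (0 : 'rV[R]_d) n%:R : set (borel_rV R d)).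
  exists (ball (0 : 'rV[R]_d) k%:R); split => //; first exact: measurable_ball_rV.
  by apply/eqP; rewrite -measure_le0 leNgt; apply/negP/ball0.
have NE : N = setT.
  rewrite -subTset => x _; apply: NT; exists (Num.truncn `|x|).+1 => //.
  by rewrite -ball_normE/= sub0r normrN truncnS_gt.
have := probability_setT mu; rewrite -NE => mu1.
by have := N0; rewrite [LHS]mu1 => /eqP; rewrite onee_eq0.
Qed.

(** * The Frostman condition outside a small set *)

Lemma grid_cover (R : realType) d (L r : R) : 0 < r ->
  exists N, forall x : 'rV[R]_d, ball 0 L x ->
    exists z : {ffun 'I_d -> 'I_N}, ball (grid_point L r z) r x.
Proof.
move=> r0; exists (Num.truncn (L / r *+ 2)).+1 => x xL.
have {}xL : `|x| < L by move: xL; rewrite -ball_normE/= sub0r normrN.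
have bounds i : 0 <= (x ord0 i + L) / r < L / r *+ 2.
  have := le_lt_trans (coord_le_sup_norm x i) xL; rewrite ltr_norml => /andP[? ?].
  rewrite divr_ge0 ?ltW//=; last by lra.
  by rewrite -mulr_natr mulrAC ltr_pM2r ?invr_gt0//; lra.
exists [ffun i => inord (Num.truncn ((x ord0 i + L) / r))].
split=> // i j; rewrite (ord1 i) /ball/= !mxE ffunE.
have /andP[b1 b2] := bounds j.
rewrite inordK; last by rewrite ltnS le_truncn// ltW.
have /andP[t1 t2] := truncn_itv b1.
rewrite ler_pdivlMr// in t1; rewrite ltr_pdivrMr// in t2.
rewrite distrC ltr_norml; move: t2; rewrite -natr1 mulrDl mul1r => t2.
by apply/andP; split; lra.
Qed.

(** Passing from t to a smaller exponent u gains a geometric factor at each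
scale of a geometric sequence. A bad grid ball has mass m > K r^u, hence
m <= m^2 / (K r^u), so the bad balls at scale r have total mass at most
C r^(t - u) / K. Their sum over all scales is small when K is large. A point
that the grids cover and that lies in no bad ball satisfies the Frostman bound mu (ball x rho) <= M rho^u. *)
Lemma frostman_off_small_set (R : realType) d (C t u : R)
    (mu : {measure set (borel_rV R d) -> \bar R}) :
  (forall p r, mu (ball p r) \is a fin_num) ->
  0 <= C -> 0 <= u < t ->
  (forall (L r : R) N, 0 < r -> \sum_(z : {ffun 'I_d -> 'I_N})
     fine (mu (ball (grid_point L r z) (2 * r))) ^+ 2 <= C * r `^ t) ->
  forall L eps : R, 0 < eps ->
  exists2 M : R, 0 < M & exists B : set (borel_rV R d),
    [/\ measurable B, (mu B <= eps%:E)%E & forall x, ball 0 L x -> ~ B x ->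
      forall rho, 0 < rho < 1 -> (mu (ball x rho) <= (M * rho `^ u)%:E)%E].
Proof.
move=> mufin C0 /andP[u0 ut] Csum L eps eps0.
have tu0 : 0 < t - u by rewrite subr_gt0.
(* This ratio makes the gain r_k^(t - u) equal to 2^-k. *)
pose q : R := 2^-1 `^ (t - u)^-1.
have q0 : 0 < q by rewrite powR_gt0.
have q1 : q < 1.
  by apply: powR_lt1; rewrite ?invr_gt0// ltr0n invf_lt1// ltr1n.
pose r_ k := q ^+ k.
have r_0 k : 0 < r_ k by rewrite exprn_gt0.
have r_tu k : r_ k `^ (t - u) = 2^-1 ^+ k.
  rewrite /r_ -powR_mulrn ?ltW// -powRrM mulrC powRrM powR_mulrn ?powR_ge0//.
  by rewrite /q -powRrM mulVf ?gt_eqF// powRr1.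
have [N coverN] := choice (fun k => @grid_cover R d L (r_ k) (r_0 k)).
pose K : R := (2 * C + 1) / eps.
have K0 : 0 < K by rewrite divr_gt0// ltr_pwDr// mulr_ge0.
pose m k (z : {ffun 'I_d -> 'I_(N k)}) : R :=
  fine (mu (ball (grid_point L (r_ k) z) (2 * r_ k))).
pose B k : set (borel_rV R d) :=
  \big[setU/set0]_(z : {ffun 'I_d -> 'I_(N k)} | K * r_ k `^ u < m k z)
    ball (grid_point L (r_ k) z) (2 * r_ k).
have BP k : measurable (B k) /\
    (mu (B k) <= (\sum_(z | K * r_ k `^ u < m k z) m k z)%:E)%E.
  rewrite /B; elim/big_ind2 : _ => [|A a A' a' [mA Aa] [mA' Aa']|z _].
  - by rewrite measure0.
  - split; first exact: measurableU.
    rewrite EFinD; apply: le_trans (leeD Aa Aa').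
    exact: measureU2.
  - by split; [exact: measurable_ball_rV|rewrite fineK].
exists (K * (q `^ u)^-1); first by rewrite divr_gt0// powR_gt0.
exists (\bigcup_k B k); split.
- by apply: bigcup_measurable => k _; case: (BP k).
- apply: (@le_trans _ _ (\sum_(0 <= k <oo) mu (B k))%E).
    apply: measure_sigma_subadditive => // [k|]; first by case: (BP k).
    by apply: bigcup_measurable => k _; case: (BP k).
  apply: le_trans (epsilon_trick0 xpredT (ltW eps0)).
  apply: lee_nneseries => // k _; apply: le_trans (BP k).2 _.
  rewrite lee_fin.
  have Ku0 : 0 < K * r_ k `^ u by rewrite mulr_gt0// powR_gt0.
  apply: (@le_trans _ _ (C * r_ k `^ t / (K * r_ k `^ u))).
    rewrite ler_pdivlMr//; apply: le_trans (Csum L (r_ k) (N k) (r_0 k)).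
    rewrite mulr_suml big_mkcond/=; apply: ler_sum => z _.
    by case: ifPn => [Km|_]; rewrite ?sqr_ge0// expr2 ler_wpM2l ?fine_ge0// ltW.
  have -> : r_ k `^ t = r_ k `^ u * 2^-1 ^+ k.
    by rewrite -r_tu -powRD ?subrKC//; apply/implyP => _; rewrite gt_eqF.
  have -> : C * (r_ k `^ u * 2^-1 ^+ k) / (K * r_ k `^ u) = C / K * 2^-1 ^+ k.
    have : r_ k `^ u != 0 by rewrite gt_eqF// powR_gt0.
    by move: (r_ k `^ u) => v v0; field; rewrite v0 gt_eqF.
  have -> : eps / (2 ^ k.+1)%:R = eps / 2 * 2^-1 ^+ k.
    by rewrite expnS natrM natrX exprVn invfM mulrA.
  rewrite ler_wpM2r ?exprn_ge0 ?invr_ge0//.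
  by rewrite ler_pdivrMr// /K mulrC mulrA divfK ?gt_eqF//; lra.
- move=> x xL xB rho /andP[rho0 rho1].
  have [k [k1 k2]] : exists k, rho <= r_ k /\ r_ k.+1 <= rho.
    have r_small : exists k, r_ k < rho.
      have : r_ k @[k --> \oo] --> (0 : R).
        by apply: cvg_expr; rewrite ger0_norm// ltW.
      by move=> /cvgr_lt/(_ rho rho0)[k _ /(_ k (leqnn k))]; exists k.
    case: (ex_minnP r_small) => -[|k] krho kmin.
      by move: krho; rewrite /r_ expr0 ltNge ltW.
    exists k; split; last exact: ltW.
    by rewrite leNgt; apply/negP => /kmin; rewrite ltnn.
  have [z xz] := coverN k x xL.
  apply: (@le_trans _ _ (m k z)%:E).
    rewrite fineK//; apply: le_measure; rewrite ?inE; try exact: measurable_ball_rV.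
    move=> y xy; rewrite (_ : 2 * r_ k = r_ k + r_ k); last by rewrite mulr_natl.
    by apply: ball_triangle xz _; exact: le_ball xy.
  rewrite lee_fin; apply: (@le_trans _ _ (K * r_ k `^ u)).
    rewrite leNgt; apply/negP => Kz; apply: xB; exists k => //.
    rewrite /B (bigD1 z)//=; left.
    by apply: le_ball xz; rewrite ler_peMl ?ler1n// ltW.
  rewrite -mulrA; apply: ler_wpM2l; first exact: ltW.
  rewrite mulrC ler_pdivlMr ?powR_gt0// -powRM; [|exact: ltW|exact: ltW].
  apply: ge0_ler_powR => //.
  + by rewrite nnegrE mulr_ge0// ltW.
  + by rewrite nnegrE ltW.
  + by rewrite mulrC -exprS.
Qed.

(** * The mass distribution principle *)

Lemma hausdorff_null_cover (R : realType) d (u delta eps : R)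
    (E : set 'rV[R]_d) : hausdorff_measure u E = 0%E -> 0 < delta -> 0 < eps ->
  exists U : (set 'rV[R]_d)^nat, [/\ E `<=` \bigcup_i U i,
    forall i, (diam (U i) <= delta%:E)%E &
    (\sum_(0 <= i <oo) diam_pow u (U i) < eps%:E)%E].
Proof.
move=> HE0 delta0 eps0.
have : (hausdorff_pre u delta E < eps%:E)%E.
  apply: (@le_lt_trans _ _ 0%E); last by rewrite lte_fin.
  by rewrite -HE0; apply: ereal_sup_ubound; exists delta.
by case/ereal_inf_lt => _ [U [EU Udelta] <-] Ueps; exists U.
Qed.

(** The Frostman bound passes to closed balls at the cost of doubling the
radius. For D = 0 and u > 0 there is nothing to double: small open balls around
x show that x is not an atom. For D = 0 = u the bound uses that 0 `^ 0 = 1. *)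
Lemma measure_dist_le (R : realType) d
    (mu : {measure set (borel_rV R d) -> \bar R}) (u M D : R) (x : 'rV[R]_d) :
  0 <= u -> 0 < M -> 0 <= D < 2^-1 ->
  (forall rho, 0 < rho < 1 -> (mu (ball x rho) <= (M * rho `^ u)%:E)%E) ->
  (mu [set y : 'rV[R]_d | (`|y - x| <= D)%R] <= (M * (2 * D) `^ u)%:E)%E.
Proof.
move=> u0 M0 /andP[D0 D12] muball; set H := [set y | _].
have muH rho : 0 < rho < 1 -> D < rho -> (mu H <= (M * rho `^ u)%:E)%E.
  move=> rho01 Drho; apply: le_trans (muball _ rho01).
  apply: le_measure; rewrite ?inE.
  - exact: measurable_dist_le.
  - exact: measurable_ball_rV.
  - by move=> y /= yx; rewrite -ball_normE/= distrC; exact: le_lt_trans Drho.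
have [Dpos|] := ltP 0 D; first by apply: muH; lra.
move=> D_le0; have {D0 D_le0}D0 : D = 0 by apply/eqP; rewrite eq_le D0 D_le0.
rewrite D0 mulr0; have [{u0}u0|] := ltP 0 u; last first.
  move=> u_le0; have {u_le0}uE : u = 0 by apply/eqP; rewrite eq_le u0 u_le0.
  apply: le_trans (muH 2^-1 _ _) _; rewrite ?D0; [lra|lra|].
  by rewrite uE !powRr0.
rewrite powR0 ?gt_eqF// mulr0; apply/lee_addgt0Pr => e e0; rewrite add0e.
pose h := Num.min 2^-1 (e / M).
have h0 : 0 < h by rewrite /h lt_min invr_gt0 ltr0n divr_gt0.
have hu0 : 0 < h `^ u^-1 by rewrite powR_gt0.
have hu1 : h `^ u^-1 < 1.
  by apply: powR_lt1; rewrite ?invr_gt0// h0 gt_min invf_lt1// ltr1n.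
apply: (@le_trans _ _ (M * (h `^ u^-1) `^ u)%:E).
  by apply: muH; rewrite ?hu0 ?D0.
rewrite lee_fin -powRrM mulVf ?gt_eqF// powRr1 ?(ltW h0)//.
by rewrite -ler_pdivlMl// mulrC /h ge_min lexx orbT.
Qed.

(** Mass distribution principle: a cover of E by sets of small diameter yields a
cover of the points of E where the Frostman bound holds by closed balls centered
at such points, whose total mass is controlled by the sum of the diam^u. *)
Lemma hausdorff_null_small_measure (R : realType) d
    (mu : {measure set (borel_rV R d) -> \bar R}) (u M : R)
    (E G : set 'rV[R]_d) : 0 <= u -> 0 < M ->
  (forall x, G x ->
    forall rho, 0 < rho < 1 -> (mu (ball x rho) <= (M * rho `^ u)%:E)%E) ->
  hausdorff_measure u E = 0%E -> forall eps : R, 0 < eps ->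
  exists A : set (borel_rV R d),
    [/\ measurable A, G `&` E `<=` A & (mu A <= eps%:E)%E].
Proof.
move=> u0 M0 muG HE0 eps eps0.
pose K := M * 2 `^ u.
have K0 : 0 < K by rewrite mulr_gt0// powR_gt0.
(* Any bound on the diameters below 1/2 would do: doubled radii must be < 1. *)
have d0 : 0 < 3^-1 :> R by rewrite invr_gt0.
have [U [EU Ud Usum]] := hausdorff_null_cover HE0 d0 (divr_gt0 eps0 K0).
have pow0 i : (0 <= diam_pow u (U i))%E.
  by rewrite /diam_pow; case: ifP => // _; exact: poweR_ge0.
(* A member of the cover that misses G is replaced by the empty set, the others
   by the closed ball around a point of G with the diameter as radius. *)
have H i : exists A : set (borel_rV R d), [/\ measurable A,
    G `&` U i `<=` A & (mu A <= K%:E * diam_pow u (U i))%E].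
  have [GU0|/set0P[x [Gx Ux]]] := eqVneq (G `&` U i) set0.
    exists set0; split=> //; first by rewrite GU0.
    by rewrite measure0 mule_ge0// lee_fin ltW.
  have diam_ub y z : U i y -> U i z -> ((enorm (y - z))%:E <= diam (U i))%E.
    by move=> Uy Uz; apply: ereal_sup_ubound; exists (y, z).
  have diam_ge0 : (0 <= diam (U i))%E.
    by apply: le_trans (diam_ub x x Ux Ux); rewrite lee_fin sqrtr_ge0.
  have [D DE] : exists D, diam (U i) = D%:E.
    exists (fine (diam (U i))); rewrite fineK// ge0_fin_numE//.
    exact: le_lt_trans (Ud i) (ltry _).
  have D01 : 0 <= D < 2^-1.
    move: diam_ge0 (Ud i); rewrite DE !lee_fin; lra.
  exists [set y : 'rV[R]_d | `|y - x| <= D]; split.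
  - exact: measurable_dist_le.
  - move=> y [_ Uy]; apply: le_trans (sup_norm_le_enorm _) _.
    by rewrite -lee_fin -DE; exact: diam_ub.
  - apply: le_trans (measure_dist_le u0 M0 D01 (muG x Gx)) _.
    rewrite /diam_pow ifF; last by apply/eqP => U0; rewrite U0 in Ux.
    rewrite DE poweR_EFin -EFinM lee_fin /K -mulrA powRM//.
    by case/andP: D01.
have [A /all_and3[mA GA muA]] := choice H.
exists (\bigcup_i A i); split.
- by apply: bigcup_measurable => i _.
- by move=> x [Gx /EU[i _ Ux]]; exists i => //; exact: GA.
- apply: (@le_trans _ _ (\sum_(0 <= i <oo) mu (A i))%E).
    by apply: measure_sigma_subadditive => //; exact: bigcup_measurable.
  apply: (@le_trans _ _ (\sum_(0 <= i <oo) K%:E * diam_pow u (U i))%E).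
    by apply: lee_nneseries.
  rewrite nneseriesZl//.
  apply: (@le_trans _ _ (K%:E * (eps / K)%:E)%E).
    by apply: lee_wpmul2l; [rewrite lee_fin ltW|exact: ltW].
  by rewrite -EFinM lee_fin mulrC divfK// gt_eqF.
Qed.

(** * The dimension of the support *)

Theorem corollary2p11 (R : realType) (d : nat) (hd : (1 <= d)%N)
    (s c : R) (hs : 0 < s) (hc : 0 < c)
    (x : nat -> 'rV[R]_d)
    (hcard : forall n : nat, (1 <= n)%N -> #|` first_points x n| = n)
    (hadapt : adaptable s (first_points x))
    (mu : probability (borel_rV R d) R)
    (hcvg : weak_star_cvg (fun n => kappa s c n (first_points x n)) mu) :
  (s%:E <= hausdorff_dim (supp mu))%E.
Proof.
apply: le_ereal_inf_tmp => _ [u [u0 Hu0] <-].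
rewrite lee_fin leNgt; apply/negP => us.
pose t := (u + s) / 2.
have [ut ts] : u < t /\ t < s by rewrite /t; lra.
have t0 : 0 < t by exact: le_lt_trans ut.
have mufin p r : mu (ball p r) \is a fin_num.
  by rewrite fin_num_measure//; exact: measurable_ball_rV.
have [|C C0 Csum] := @sum_grid_ball_sqr_le _ _ s c t _ mu hs hc _ hadapt hcvg.
  by rewrite t0.
have [n mun] := exists_ball_measure_gt0 mu.
pose m := fine (mu (ball (0 : 'rV[R]_d) n%:R)).
have m0 : 0 < m by rewrite fine_gt0// mun ltey_eq mufin.
have m3 : 0 < m / 3 by rewrite divr_gt0.
have u0t : 0 <= u < t by rewrite u0.
have [M M0 [B [mB muB frostman]]] :=
  frostman_off_small_set mufin C0 u0t Csum n%:R m3.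
have [|A [mA EA muA]] := @hausdorff_null_small_measure _ _ mu u M (supp mu)
  (ball 0 n%:R `\` B) u0 M0 _ Hu0 _ m3.
  by move=> y [yn yB]; exact: frostman.
have [N [mN N0 suppN]] := negligible_setC_supp mu.
have : (mu (ball (0 : 'rV[R]_d)%R n%:R%R) <= mu (B `|` A `|` N))%E.
  apply: le_measure; rewrite ?inE; first exact: measurable_ball_rV.
    by apply: measurableU => //; exact: measurableU.
  move=> y yn; have [By|nB] := pselect (B y); first by left; left.
  have [sy|nsy] := pselect (supp mu y); first by left; right; exact: EA.
  by right; exact: suppN.
have mBA : measurable (B `|` A) by exact: measurableU.
move=> /le_trans/(_ (measureU2 _ mBA mN)).
rewrite [X in (_ + X)%E]N0 adde0.
move=> /le_trans/(_ (measureU2 _ mB mA))/le_trans/(_ (leeD muB muA)).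
rewrite -(fineK (mufin _ _)) -EFinD lee_fin -/m; lra.
Qed.
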